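(* Let $p$ be prime, $m\ge1$, $R=\mathbb Z_{p^m}[x_1^{\pm1},\dots,x_D^{\pm1}]$, let $\mathbf f=(f_1,\dots,f_D)$ be a regular sequence in $R$ of length $D$, and $S:=R/(\mathbf f)$. For each $a$ let $J_a:=\min\{\ell\in\mathbb Z_{>0}:[x_a]^\ell=[1]\text{ in }S\}$ (finite, since $S$ is finite). Let $\mathbf L=(L_1,\dots,L_D)\in\mathbb Z_{>0}^D$, $g_a=\gcd(L_a,J_a)$, and $\mathbf g=(g_1,\dots,g_D)$. Then, for every $j$, $$\mathcal H_j^Z(\mathbf L)\cong_R\mathcal H_j^Z(\mathbf g),\qquad\text{and hence}\qquad k_j(\mathbf L)=k_j(\mathbf g).$$
   Context: A sequence $(f_1,\dots,f_s)$ is regular if $f_1$ is a non-zero-divisor in $R$ and each $f_i$ ($2\le i\le s$) is a non-zero-divisor on $R/(f_1,\dots,f_{i-1})$. For $\mathbf L\in\mathbb Z_{>0}^D$, $R_{\mathbf L}:=R/(x_1^{L_1}-1,\dots,x_D^{L_D}-1)$. The Koszul complex $K_\bullet(\mathbf f)$: $K_i(\mathbf f)=\bigwedge^iR^D$, $\partial_i(e_{a_1}\wedge\cdots\wedge e_{a_i})=\sum_{k=1}^i(-1)^{k-1}f_{a_k}e_{a_1}\wedge\cdots\widehat{e_{a_k}}\cdots\wedge e_{a_i}$. Set $\mathcal H_j^Z(\mathbf L):=H_j(K_\bullet(\mathbf f)\otimes_RR_{\mathbf L})$, an $R$-module, and $k_j(\mathbf L):=\log_p|\mathcal H_j^Z(\mathbf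 L)|$. *)

(* Defs.v *)
From HB Require Import structures.
From mathcomp Require Import all_boot all_order all_algebra.
From mathcomp Require Import finmap.
From mathcomp Require Import boolp classical_sets functions cardinality.
From mathcomp Require Import monalg.

Set Implicit Arguments.
Unset Strict Implicit.
Unset Printing Implicit Defensive.

Import GRing.Theory.
Local Open Scope ring_scope.
Local Open Scope quotient_scope.

(* The algebra [{malg A[K]}] of multinomials carries a product only when K is
   a [monomType], which excludes nontrivial groups; here is the product of the
   group algebra A[G] of an abelian group G (written additively). *)
Section GroupAlgebra.
Variables (G : zmodType) (A : comNzRingType).

Definition galg : Type := {malg A[G]}.
HB.instance Definition _ := GRing.Zmodule.on galg.

Implicit Types x y z : galg.

Definition galg_one : galg := << (0 : G) >>.

Definition galg_mul x y : galg :=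
  \sum_(k <- msupp x) \sum_(l <- msupp y) << x@_k * y@_l *g k + l >>.

Lemma galg_mulw (d e : {fset G}) x y :
  (msupp x `<=` d)%fset -> (msupp y `<=` e)%fset ->
  galg_mul x y = \sum_(k <- d) \sum_(l <- e) << x@_k * y@_l *g k + l >>.
Proof.
move=> le_d le_e; rewrite /galg_mul (big_fset_incl _ le_d) /=; last first.
  move=> k _ /mcoeff_outdom xk.
  by rewrite big1 // => l _; rewrite xk mul0r monalgU0.
apply: eq_bigr => k _; apply: big_fset_incl => // l _ /mcoeff_outdom ->.
by rewrite mulr0 monalgU0.
Qed.

Lemma galg_mulC : commutative galg_mul.
Proof.
move=> x y; rewrite /galg_mul exchange_big /=; apply: eq_bigr => l _.
by apply: eq_bigr => k _; rewrite mulrC addrC.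
Qed.

Lemma galg_mulDl : left_distributive galg_mul +%R.
Proof.
move=> x y z.
rewrite (galg_mulw (msuppD_le x y) (fsubset_refl (msupp z))).
rewrite (galg_mulw (fsubsetUl (msupp x) (msupp y)) (fsubset_refl (msupp z))).
rewrite (galg_mulw (fsubsetUr (msupp x) (msupp y)) (fsubset_refl (msupp z))).
rewrite -big_split /=; apply: eq_bigr => k _.
rewrite -big_split /=; apply: eq_bigr => l _.
by rewrite mcoeffD mulrDl monalgUD.
Qed.

Lemma galg_mulDr : right_distributive galg_mul +%R.
Proof. by move=> x y z; rewrite !(galg_mulC x) galg_mulDl. Qed.

Lemma galg_mul0 : left_zero 0 galg_mul.
Proof. by move=> x; rewrite /galg_mul msupp0 big_seq_fset0. Qed.

Lemma galg_mulx0 : right_zero 0 galg_mul.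
Proof. by move=> x; rewrite galg_mulC galg_mul0. Qed.

Lemma galg_mulUU (a b : A) (k l : G) :
  galg_mul << a *g k >> << b *g l >> = << a * b *g k + l >>.
Proof. by rewrite (galg_mulw msuppU_le msuppU_le) !big_seq_fset1 !mcoeffUU. Qed.

Lemma galg_mul_suml (I : Type) (s : seq I) (F : I -> galg) y :
  galg_mul (\sum_(i <- s) F i) y = \sum_(i <- s) galg_mul (F i) y.
Proof.
exact: (big_morph (galg_mul^~ y) (fun _ _ => galg_mulDl _ _ _) (galg_mul0 _)).
Qed.

Lemma galg_mul_sumr (I : Type) (s : seq I) (F : I -> galg) x :
  galg_mul x (\sum_(i <- s) F i) = \sum_(i <- s) galg_mul x (F i).
Proof.
exact: (big_morph (galg_mul x) (fun _ _ => galg_mulDr _ _ _) (galg_mulx0 _)).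
Qed.

Lemma galgE x : x = \sum_(k <- msupp x) (<< x@_k *g k >> : galg).
Proof. exact: monalgE. Qed.

Lemma galg_mulA : associative galg_mul.
Proof.
move=> x y z; rewrite (galgE x) 3!galg_mul_suml; apply: eq_bigr => k _.
rewrite (galgE y) galg_mul_suml 2!galg_mul_sumr galg_mul_suml.
apply: eq_bigr => l _; rewrite (galgE z) 3!galg_mul_sumr.
by apply: eq_bigr => j _; rewrite !galg_mulUU mulrA addrA.
Qed.

Lemma galg_mul1 : left_id galg_one galg_mul.
Proof.
move=> x; rewrite [in LHS](galgE x) galg_mul_sumr [RHS]galgE.
by apply: eq_bigr => k _; rewrite galg_mulUU mul1r add0r.
Qed.

Lemma galg_one_neq0 : galg_one != 0.
Proof.
apply/eqP => /(congr1 (mcoeff (0 : G))) /eqP.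
by rewrite /galg_one mcoeffUU mcoeff0 oner_eq0.
Qed.

HB.instance Definition _ := GRing.Zmodule_isComNzRing.Build galg
  galg_mulA galg_mulC galg_mul1 galg_mulDl galg_one_neq0.

End GroupAlgebra.

(* A[x_1^{+-1}, .., x_D^{+-1}] = A[Z^D], with monomial x^k = << k >>. *)
Definition laurent (D : nat) (A : comNzRingType) : comNzRingType :=
  galg {ffun 'I_D -> int} A.

Definition lvar (D : nat) (A : comNzRingType) (a : 'I_D) : laurent D A :=
  << ([ffun b => (b == a)%:Z] : {ffun 'I_D -> int}) >>.

Section ModuleQuotient.
Variables (R : pzRingType) (V : lmodType R) (B : submodClosed V).

(* B itself, with the closure under opposite that [Quotient.quot] asks for *)
Definition submod_pred : {pred V} := fun v => v \in B.

Lemma submod_pred_zmod : zmod_closed submod_pred.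
Proof.
split=> [|u v Bu Bv]; first exact: (rpred0 B).
by rewrite -scaleN1r; apply: (@rpredD _ B) => //; apply: (@rpredZ _ _ B).
Qed.

HB.instance Definition _ :=
  GRing.isZmodClosed.Build V submod_pred submod_pred_zmod.

Definition mquot : Type := Quotient.quot submod_pred.
HB.instance Definition _ := Choice.on mquot.
HB.instance Definition _ := GRing.Zmodule.on mquot.

Definition mpi (v : V) : mquot := \pi_(Quotient.quot submod_pred) v.

Definition mrepr (x : mquot) : V := repr (x : Quotient.quot submod_pred).

Lemma mreprK : cancel mrepr mpi.
Proof. exact: reprK. Qed.

Lemma mpi_eq u v : (mpi u == mpi v) = (u - v \in B).
Proof. by rewrite -[RHS]/(u - v \in submod_pred) Quotient.idealrBE. Qed.

Lemma mpi_surj (x : mquot) : exists v, mpi v = x.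
Proof. by exists (mrepr x); rewrite mreprK. Qed.

Lemma mpiB : {morph mpi : u v / u - v}.
Proof. by move=> u v; rewrite /mpi !piE. Qed.

HB.instance Definition _ := GRing.isZmodMorphism.Build V mquot mpi mpiB.

Definition mquot_scale (r : R) (x : mquot) : mquot :=
  mpi (r *: mrepr x).

Lemma mquot_scaleE r v : mquot_scale r (mpi v) = mpi (r *: v).
Proof.
by apply/eqP; rewrite mpi_eq -scalerBr; apply: rpredZ; rewrite -mpi_eq mreprK.
Qed.

Lemma mquot_scaleA r s x :
  mquot_scale r (mquot_scale s x) = mquot_scale (r * s) x.
Proof. by have [v <-] := mpi_surj x; rewrite !mquot_scaleE scalerA. Qed.

Lemma mquot_scale1 : left_id 1 mquot_scale.
Proof. by move=> x; have [v <-] := mpi_surj x; rewrite mquot_scaleE scale1r. Qed.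

Lemma mquot_scaleDr : right_distributive mquot_scale +%R.
Proof.
move=> r x y; have [u <-] := mpi_surj x; have [v <-] := mpi_surj y.
by rewrite -raddfD !mquot_scaleE scalerDr raddfD.
Qed.

Lemma mquot_scaleDl x : {morph mquot_scale^~ x : r s / r + s}.
Proof.
move=> r s; have [v <-] := mpi_surj x.
by rewrite !mquot_scaleE scalerDl raddfD.
Qed.

HB.instance Definition _ := GRing.Zmodule_isLmodule.Build R mquot
  mquot_scaleA mquot_scale1 mquot_scaleDr mquot_scaleDl.

Lemma mpiZ : scalable mpi.
Proof. by move=> r v; rewrite -mquot_scaleE. Qed.

HB.instance Definition _ := GRing.isScalable.Build R V mquot *:%R mpi mpiZ.

End ModuleQuotient.

(* Unlike [{ideal_quot _}], this does not require the ideal to be proper. *)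
Section RingQuotient.
Variables (R : comPzRingType) (I : submodClosed R^o).

Definition rquot : Type := mquot I.
HB.instance Definition _ := GRing.Lmodule.on rquot.

Definition rpi (r : R) : rquot := mpi I r.

Definition rquot_mul (x y : rquot) : rquot := mrepr x *: y.

Lemma rpi_surj (x : rquot) : exists r, rpi r = x.
Proof. by have [r <-] := mpi_surj x; exists r. Qed.

Lemma rquot_mulE r s : rquot_mul (rpi r) (rpi s) = rpi (r * s).
Proof.
have It : mrepr (rpi r) - (r : R^o) \in I by rewrite -mpi_eq mreprK.
rewrite /rquot_mul -[_ *: _]/(mquot_scale _ _) mquot_scaleE.
apply/eqP; rewrite mpi_eq -[_ - _]mulrBl mulrC.
exact: (@rpredZ _ _ I s _ It).
Qed.

Lemma rquot_mulA : associative rquot_mul.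
Proof.
move=> x y z; have [a <-] := rpi_surj x; have [b <-] := rpi_surj y.
by have [c <-] := rpi_surj z; rewrite !rquot_mulE mulrA.
Qed.

Lemma rquot_mulC : commutative rquot_mul.
Proof.
move=> x y; have [a <-] := rpi_surj x; have [b <-] := rpi_surj y.
by rewrite !rquot_mulE mulrC.
Qed.

Lemma rquot_mul1 : left_id (rpi 1) rquot_mul.
Proof. by move=> x; have [a <-] := rpi_surj x; rewrite rquot_mulE mul1r. Qed.

Lemma rquot_mulDl : left_distributive rquot_mul +%R.
Proof.
move=> x y z; have [a <-] := rpi_surj x; have [b <-] := rpi_surj y.
have [c <-] := rpi_surj z.
by rewrite /rpi -raddfD !rquot_mulE mulrDl /rpi raddfD.
Qed.

HB.instance Definition _ := GRing.Zmodule_isComPzRing.Build rquot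
  rquot_mulA rquot_mulC rquot_mul1 rquot_mulDl.

Lemma rpiB : zmod_morphism rpi.
Proof. by move=> r s; rewrite /rpi -mpiB. Qed.

Lemma rpiM : monoid_morphism rpi.
Proof. by split=> // r s; rewrite -rquot_mulE. Qed.

HB.instance Definition _ := GRing.isZmodMorphism.Build R rquot rpi rpiB.
HB.instance Definition _ := GRing.isMonoidMorphism.Build R rquot rpi rpiM.

Lemma rquot_scaleE r (x : rquot) : r *: x = rpi r * x.
Proof.
have [s <-] := rpi_surj x; rewrite -[RHS]/(rquot_mul _ _) rquot_mulE.
by rewrite /rpi -mpiZ.
Qed.

End RingQuotient.

Section Ideals.
Variables (R : comPzRingType) (n : nat).

(* The ideal generated by the f_i with P i. *)
Definition ideal_gen (P : pred 'I_n) (f : 'I_n -> R) : {pred R^o} :=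
  fun x => `[< exists c : 'I_n -> R, x = \sum_(i | P i) c i * f i >].

Lemma ideal_gen_submod P f : submod_closed (ideal_gen P f).
Proof.
split=> [|r x y /asboolP[c ->] /asboolP[d ->]]; apply/asboolP.
  by exists (fun=> 0); rewrite big1 // => i _; rewrite mul0r.
exists (fun i => r * c i + d i); rewrite scaler_sumr -big_split /=.
by apply: eq_bigr => i _; rewrite mulrDl -[_ *: _]/(r * _) mulrA.
Qed.

HB.instance Definition _ P f :=
  GRing.isSubmodClosed.Build R R^o (ideal_gen P f) (ideal_gen_submod P f).

(* R / (f_1, .., f_n) *)
Definition rmod (f : 'I_n -> R) := rquot (ideal_gen predT f).

Definition nonzerodivisor (A : comPzRingType) (a : A) :=
  forall x : A, a * x = 0 -> x = 0.

(* For i = 0 the quotient is R / (0) = R. No properness of (f_1, .., f_n) is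
   required. *)
Definition regular_seq (f : 'I_n -> R) := forall i : 'I_n,
  nonzerodivisor (rpi (ideal_gen [pred j : 'I_n | (j < i)%N] f) (f i)).

End Ideals.

Section Homology.
Variables (R : pzRingType) (U V W : lmodType R).
Variables (d : {linear U -> V}) (d' : {linear V -> W}).

Definition cyclep : {pred V} := fun v => d' v == 0.

Lemma cyclep_submod : submod_closed cyclep.
Proof.
split=> [|r u v]; rewrite /in_mem /= /cyclep ?linear0 //.
by move=> /eqP u0 /eqP v0; rewrite linearP u0 v0 scaler0 addr0.
Qed.

HB.instance Definition _ :=
  GRing.isSubmodClosed.Build R V cyclep cyclep_submod.

Record cycles : Type := Cycle { cycle_val :> V; _ : cycle_val \in cyclep }.

HB.instance Definition _ := [isSub for cycle_val].
HB.instance Definition _ := [Choice of cycles by <:].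
HB.instance Definition _ := [SubChoice_isSubLmodule of cycles by <:].

Definition boundaryp : {pred cycles} :=
  fun z => `[< exists u : U, val z = d u >].

Lemma boundaryp_submod : submod_closed boundaryp.
Proof.
split=> [|r y z /asboolP[u yu] /asboolP[v zv]]; apply/asboolP.
  by exists 0; rewrite !linear0.
by exists (r *: u + v); rewrite [RHS]linearP -yu -zv.
Qed.

HB.instance Definition _ :=
  GRing.isSubmodClosed.Build R cycles boundaryp boundaryp_submod.

(* ker d' / im d, for a complex U -d-> V -d'-> W *)
Definition homology := mquot boundaryp.

End Homology.

Section Koszul.
Variables (R : comNzRingType) (n : nat) (f : 'I_n -> R).

Definition isub (i : nat) := {A : {set 'I_n} | #|A| == i}.

(* [kos M i] is K_i(f) (x)_R M. The module K_i(f) = /\^i R^n is free on the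
   e_A = e_{a_1} /\ .. /\ e_{a_i}, for A = {a_1 < .. < a_i}, so that
   K_i(f) = [kos R^o i], and u : kos M i stands for \sum_A e_A (x) u A.
   See [ktensor_univ] and [kdiff_tensor] below. *)
Definition kos (M : lmodType R) (i : nat) := {ffun isub i -> M}.

(* e_A (x) x in degree i; this is 0 unless #|A| = i. *)
Definition kwedge (M : lmodType R) i (A : {set 'I_n}) (x : M) : kos M i :=
  [ffun B => if val B == A then x else 0].

(* If A = {a_1 < .. < a_i} and a = a_k then [kpos A a] = k - 1. *)
Definition kpos (A : {set 'I_n}) (a : 'I_n) := #|[set b in A | (b < a)%N]|.

(* The differential K_i -> K_k, when k = i - 1; otherwise this is 0. *)
Definition kdiff (M : lmodType R) i k (u : kos M i) : kos M k :=
  \sum_(A : isub i) \sum_(a in val A)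
    kwedge k (val A :\ a) (((-1) ^+ kpos (val A) a * f a) *: u A).

Lemma kwedge_linear (M : lmodType R) i A : linear (@kwedge M i A).
Proof.
move=> r x y; apply/ffunP => B; rewrite !ffunE.
by case: ifP; rewrite ?scaler0 ?addr0.
Qed.

HB.instance Definition _ (M : lmodType R) i A :=
  GRing.isLinear.Build R M (kos M i) *:%R (@kwedge M i A)
    (@kwedge_linear M i A).

Lemma kdiff_linear (M : lmodType R) i k : linear (@kdiff M i k).
Proof.
move=> r u v; rewrite /kdiff scaler_sumr -big_split /=.
apply: eq_bigr => A _; rewrite scaler_sumr -big_split /=.
apply: eq_bigr => a _; rewrite -linearP; congr (kwedge _ _ _).
by rewrite !ffunE scalerDr !scalerA mulrC.
Qed.

HB.instance Definition _ (M : lmodType R) i k :=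
  GRing.isLinear.Build R (kos M i) (kos M k) *:%R (@kdiff M i k)
    (@kdiff_linear M i k).

(* H_j(K(f) (x)_R M) *)
Definition koszulH (M : lmodType R) (j : nat) :=
  homology (@kdiff M j.+1 j) (@kdiff M j j.-1).

Lemma kos_wedgeE (M : lmodType R) i (u : kos M i) :
  u = \sum_(A : isub i) kwedge i (val A) (u A).
Proof.
apply/ffunP => B; rewrite sum_ffunE (bigD1 B) //= ffunE eqxx big1 ?addr0 //.
by move=> A AB; rewrite ffunE (inj_eq val_inj) eq_sym (negPf AB).
Qed.

Lemma kdiff_wedge (M : lmodType R) i k (A : {set 'I_n}) (x : M) :
  #|A| = i -> kdiff k (kwedge i A x) =
    \sum_(a in A) ((-1) ^+ kpos A a * f a) *: kwedge k (A :\ a) x.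
Proof.
move=> cA; have cA' : #|A| == i by apply/eqP.
rewrite /kdiff (bigD1 (exist _ A cA' : isub i)) //= [X in _ + X]big1 => [|B BA].
  by rewrite addr0; apply: eq_bigr => a _; rewrite ffunE eqxx linearZ.
rewrite big1 // => a _; rewrite ffunE; case: eqP => [BAe|_].
  by case/eqP: BA; apply: val_inj.
by rewrite scaler0 linear0.
Qed.

Definition ktensor (M : lmodType R) i (v : kos R^o i) (x : M) : kos M i :=
  [ffun A => (v A : R) *: x].

Lemma kdiff_tensor (M : lmodType R) i k (v : kos R^o i) (x : M) :
  kdiff k (ktensor v x) = ktensor (kdiff k v) x.
Proof.
apply/ffunP => B; rewrite !ffunE /kdiff !sum_ffunE scaler_suml.
apply: eq_bigr => A _; rewrite !sum_ffunE scaler_suml.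
apply: eq_bigr => a _; rewrite !ffunE.
by case: ifP; rewrite ?scale0r // scalerA.
Qed.

Lemma ktensor_univ (M P : lmodType R) i (phi : kos R^o i -> M -> P) :
  (forall v, linear (phi v)) -> (forall x, linear (phi^~ x)) ->
  exists g : {linear kos M i -> P},
    (forall v x, g (ktensor v x) = phi v x) /\
    (forall h : {linear kos M i -> P},
       (forall v x, h (ktensor v x) = phi v x) -> h =1 g).
Proof.
move=> lr ll; pose e (A : isub i) : kos R^o i := kwedge i (val A) (1 : R^o).
pose g (u : kos M i) := \sum_(A : isub i) phi (e A) (u A).
have gl : linear g.
  move=> r u v; rewrite /g scaler_sumr -big_split /=.
  by apply: eq_bigr => A _; rewrite !ffunE lr.
pose gL := HB.pack_for {linear kos M i -> P} g
  (GRing.isLinear.Build R (kos M i) P *:%R g gl).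
have phi0 x : phi 0 x = 0.
  by have := ll x (-1) 0 0; rewrite scaler0 addr0 scaleN1r addNr.
exists gL; split=> [v x|h hE].
  rewrite [RHS](_ : _ = phi (\sum_(A : isub i) v A *: e A) x); last first.
    congr (phi _ x); rewrite [LHS]kos_wedgeE; apply: eq_bigr => A _.
    by rewrite -linearZ /= /GRing.scale /= mulr1.
  rewrite (big_morph (phi^~ x) (id1 := 0) (op1 := +%R)) ?phi0 //; last first.
    by move=> u w; have := ll x 1 u w; rewrite !scale1r.
  rewrite /= /g; apply: eq_bigr => A _; rewrite ffunE.
  have := lr (e A) (v A) x 0; rewrite addr0 => ->.
  have -> : phi (e A) 0 = 0.
    by have := lr (e A) (-1) 0 0; rewrite scaler0 addr0 scaleN1r addNr.
  have := ll x (v A) (e A) 0; rewrite phi0 !addr0 => ->.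
  by [].
move=> u; rewrite {1}[u]kos_wedgeE linear_sum /= /g; apply: eq_bigr => A _.
rewrite -hE; congr (h _); apply/ffunP => B; rewrite !ffunE.
by case: ifP; rewrite ?scale1r ?scale0r.
Qed.

End Koszul.

Definition lmod_iso (R : pzRingType) (M N : lmodType R) : Prop :=
  exists phi : {linear M -> N}, bijective phi.

(* The least l > 0 such that x ^+ l = 1; by convention 0 if there is none. *)
Definition mult_order (S : pzRingType) (x : S) : nat :=
  if pselect (exists l : nat, (0 < l)%N && (x ^+ l == 1)) is left ex
  then ex_minn ex else 0%N.

Lemma mult_orderP (S : pzRingType) (x : S) : (0 < mult_order x)%N ->
  x ^+ mult_order x = 1 /\
  forall l, (0 < l)%N -> x ^+ l = 1 -> (mult_order x <= l)%N.
Proof.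
rewrite /mult_order; case: pselect => // ex _.
case: ex_minnP => j /andP[_ /eqP xj] jmin; split=> // l l0 xl.
by apply: jmin; rewrite l0 xl eqxx.
Qed.

(* |T|, for T finite *)
Definition card_of (T : choiceType) : nat := #|` fset_set [set: T]|%fset.

Section Laurent.
Variables (D : nat) (A : comNzRingType).
Local Notation R := (laurent D A).

(* R_L = R / (x_1^L_1 - 1, .., x_D^L_D - 1) *)
Definition R_quo (L : 'I_D -> nat) := rmod (fun a => lvar A a ^+ L a - 1 : R).

(* H_j^Z(L) = H_j(K(f) (x)_R R_L) *)
Definition HZ (f : 'I_D -> R) (L : 'I_D -> nat) (j : nat) : lmodType R :=
  koszulH f (R_quo L) j.

(* J_a, the order of [x_a] in S = R / (f) *)
Definition Jord (f : 'I_D -> R) (a : 'I_D) : nat :=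
  mult_order (rpi (ideal_gen predT f) (lvar A a)).

(* k_j(L) = log_p |H_j^Z(L)| *)
Definition kZ (p : nat) (f : 'I_D -> R) (L : 'I_D -> nat) (j : nat) : nat :=
  trunc_log p (card_of (HZ f L j)).

End Laurent.

(* Main.v *)
(* Finiteness of R/(f): a nonzerodivisor f_i lowers the growth exponent of the
   images of the boxes of exponents [-n, n]^D by one, so that after D steps these
   images have bounded size.

   The isomorphism: change one coordinate a at a time, say L_a into L'_a, and put
   M = R/(x_b^L_b - 1 : b <> a), y = x_a^L_a - 1 and y' = x_a^L'_a - 1, which are
   nonzerodivisors on M. Then H_j(f; M/yM) is the homology of the cone of y on
   K(f; M). The elements of (f) act on K(f; M) by null-homotopic maps, so this
   homology depends on y only up to association in the finite ring R/(f); and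
   there x_a^L_a - 1 and x_a^g_a - 1 divide each other, hence are associates. *)
From HB Require Import structures.
Require Import Defs.
From mathcomp Require Import all_boot all_order all_algebra.
From mathcomp Require Import boolp classical_sets functions cardinality.
From mathcomp Require Import all_fingroup all_solvable finmap monalg zify ring.

Set Implicit Arguments.
Unset Strict Implicit.
Unset Printing Implicit Defensive.

Import Order.TTheory GRing.Theory.
Local Open Scope ring_scope.

(** * Homotopies on the Koszul complex *)

Section KoszulHomotopy.
Variables (R : comNzRingType) (n : nat) (f : 'I_n -> R).
Implicit Types (M N : lmodType R) (A : {set 'I_n}).

Lemma kos_ind M i (P : kos n M i -> Prop) :
  P 0 -> (forall u v, P u -> P v -> P (u + v)) ->
  (forall A (x : M), #|A| = i -> P (kwedge i A x)) -> forall u, P u.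
Proof.
move=> P0 PD Pw u; rewrite [u]kos_wedgeE.
by elim/big_ind: _ => // A _; apply/Pw/eqP/(valP A).
Qed.

(** The source of every sign comparison below: deleting two indices in either order changes the
    total exponent of -1 by one. *)
Lemma kposD A a b : a \in A -> kpos A b = (kpos (A :\ a) b + (a < b))%N.
Proof.
move=> aA; rewrite /kpos; case: ltnP => ab; last first.
  rewrite addn0; congr #|pred_of_set _|; apply/setP => c; rewrite !inE.
  by case: (eqVneq c a) => [->|//]; rewrite aA ltnNge ab.
rewrite (cardsD1 a) inE aA ab addnC; congr (_ + _)%N.
by congr #|pred_of_set _|; apply/setP => c; rewrite !inE andbA.
Qed.

(** Deleting two indices in the two possible orders gives the same wedge with opposite signs.
    Degrees use the truncated predecessor: out of degree 0 the differential is an empty sum. *)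
Lemma kdiffK M i k l (u : kos n M i) : k = i.-1 -> l = k.-1 ->
  kdiff f l (kdiff f k u) = 0.
Proof.
move=> ki lk; elim/kos_ind: u => [|u v Pu Pv|A x cA].
- by rewrite !linear0.
- by rewrite !linearD /= Pu Pv addr0.
rewrite kdiff_wedge // linear_sum /=.
pose F a b := ((-1) ^+ kpos A a * f a * ((-1) ^+ kpos (A :\ a) b * f b)) *:
  kwedge l (A :\ a :\ b) x.
have -> : \sum_(a in A) kdiff f l (((-1) ^+ kpos A a * f a) *:
    kwedge k (A :\ a) x) =
  \sum_(a in A) \sum_(b in A | b != a) F a b.
  apply: eq_bigr => a aA; rewrite linearZ /= kdiff_wedge; last first.
    by rewrite ki -cA (cardsD1 a A) aA.
  rewrite scaler_sumr; apply: eq_big => [b|b _]; first by rewrite !inE andbC.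
  by rewrite /F scalerA.
have FN a b : a \in A -> b \in A -> (b < a)%N -> F a b = - F b a.
  move=> aA bA ba; rewrite /F (kposD b aA) (kposD a bA) ba ltnNge (ltnW ba).
  rewrite -scaleNr addn0 addn1 exprS.
  have -> : A :\ a :\ b = A :\ b :\ a.
    by apply/setP => c; rewrite !inE andbCA.
  by congr (_ *: _); ring.
have sumE a : a \in A -> \sum_(b in A | b != a) F a b =
    \sum_(b in A | (a < b)%N) F a b + \sum_(b in A | (b < a)%N) F a b.
  move=> aA; rewrite (bigID (fun b : 'I_n => (a < b)%N)) /=; congr (_ + _).
    apply: eq_bigl => b; case: (ltnP a b); rewrite ?andbF // ?andbT => ab.
    by rewrite neq_ltn ab orbT andbT.
  by apply: eq_bigl => b; rewrite -leqNgt -andbA -val_eqE /= neq_ltn ltn_neqAle; lia.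
rewrite (eq_bigr _ sumE) big_split /=.
(* Exchanging the sums over [a < b] puts each [F a b] next to its opposite [F b a]. *)
rewrite (exchange_big_dep (mem A)) /= => [|a b _ /andP[]//].
rewrite -big_split /= big1 // => b bA.
have -> : \sum_(a in A | (b \in A) && (a < b)%N) F a b =
    \sum_(a in A | (a < b)%N) F a b by apply: eq_bigl => a; rewrite bA.
rewrite -big_split /= big1 // => a /andP[aA ab].
by rewrite (FN b a) // addrN.
Qed.

(* Exterior multiplication by e_a: [kpos A a] transpositions move e_a into
   place. *)
Definition kmul M a i k (u : kos n M i) : kos n M k :=
  \sum_(A : isub n i | a \notin val A)
    kwedge k (a |: val A) ((-1) ^+ kpos (val A) a *: u A).

Lemma kmul_linear M a i k : linear (@kmul M a i k).
Proof.
move=> r u v; rewrite /kmul scaler_sumr -big_split /=.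
apply: eq_bigr => A _; rewrite -linearP; congr (kwedge _ _ _).
by rewrite !ffunE scalerDr !scalerA mulrC.
Qed.

HB.instance Definition _ M a i k :=
  GRing.isLinear.Build R (kos n M i) (kos n M k) *:%R (@kmul M a i k)
    (@kmul_linear M a i k).

Lemma kmul_wedge M a i k A (x : M) : #|A| = i ->
  kmul a k (kwedge i A x) =
    if a \in A then 0 else (-1) ^+ kpos A a *: kwedge k (a |: A) x.
Proof.
move=> cA; have cA' : #|A| == i by apply/eqP.
have wE (B : isub n i) :
    kwedge i A x B = if B == exist _ A cA' then x else 0.
  by rewrite ffunE -val_eqE.
case: ifP => aA; rewrite /kmul.
  apply: big1 => B aB; rewrite wE; case: eqP => [BA|]; last by rewrite scaler0 linear0.
  by move: aB; rewrite BA /= aA.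
rewrite (bigD1 (exist _ A cA' : isub n i)) ?aA //= wE eqxx linearZ /=.
by rewrite big1 ?addr0 // => B /andP[_ /negPf]; rewrite wE => ->; rewrite scaler0 linear0.
Qed.

(** On a wedge without [e_a] the terms deleting another index cancel; on a wedge containing [e_a]
    only the deletion of [e_a] survives. So exterior multiplication by [e_a] is a null-homotopy of
    multiplication by [f a]. *)
Lemma kdiff_kmul M a j (u : kos n M j) :
  kdiff f j (kmul a j.+1 u) + kmul a j (kdiff f j.-1 u) = f a *: u.
Proof.
elim/kos_ind: u => [|u v Pu Pv|A x cA].
- by rewrite !linear0 addr0.
- by rewrite !linearD /= addrACA Pu Pv.
have sgn2 i : (-1) ^+ i * (-1) ^+ i = 1 :> R.
  by rewrite -exprD addnn -signr_odd odd_double.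
rewrite kmul_wedge // kdiff_wedge // linear_sum /=.
have cD b : b \in A -> #|A :\ b| = j.-1 by move=> bA; rewrite -cA (cardsD1 b A) bA.
case: ifP => aA.
  rewrite linear0 add0r (bigD1 a) //= big1 ?addr0 => [|b /andP[bA ba]].
    rewrite linearZ /= kmul_wedge ?cD // !inE eqxx /= finset.setD1K // scalerA.
    by rewrite (kposD a aA) ltnn addn0 mulrAC sgn2 mul1r.
  by rewrite linearZ /= kmul_wedge ?cD // !inE aA eq_sym ba /= scaler0.
have cU : #|a |: A| = j.+1 by rewrite cardsU1 aA cA.
have aaA : a \in a |: A by rewrite finset.setU11.
rewrite linearZ /= kdiff_wedge // (big_setU1 a) ?aA //= scalerDr.
have DaU : (a |: A) :\ a = A by rewrite finset.setU1K // aA.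
have kU b : kpos (a |: A) b = (kpos A b + (a < b))%N by rewrite (kposD b aaA) DaU.
rewrite DaU kU ltnn addn0 scalerA mulrA sgn2 mul1r -addrA -[RHS]addr0.
congr (_ + _); rewrite scaler_sumr -big_split /= big1 // => b bA.
have ba : b != a by apply: contraTneq bA => ->; rewrite aA.
have -> : (a |: A) :\ b = a |: (A :\ b).
  by apply/setP => c; rewrite !inE; case: eqVneq => [->|//]; rewrite (negPf ba).
rewrite [kmul _ _ _]linearZ /= kmul_wedge ?cD // !inE aA andbF scalerA kU.
rewrite (kposD a bA) scalerA -scalerDl.
have [ab|ba'|/val_inj E] := ltngtP a b; last by rewrite E eqxx in ba.
  by rewrite !addn0 addn1 exprS [X in X *: _](_ : _ = 0) ?scale0r //; ring.
by rewrite !addn0 addn1 exprS [X in X *: _](_ : _ = 0) ?scale0r //; ring.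
Qed.

(* Exterior multiplication by \sum_a c_a e_a. *)
Definition kmulv M (c : 'I_n -> R) i k (u : kos n M i) : kos n M k :=
  \sum_a c a *: kmul a k u.

Lemma kmulv_linear M c i k : linear (@kmulv M c i k).
Proof.
move=> r u v; rewrite /kmulv scaler_sumr -big_split /=.
by apply: eq_bigr => a _; rewrite linearP scalerDr !scalerA mulrC.
Qed.

HB.instance Definition _ M c i k :=
  GRing.isLinear.Build R (kos n M i) (kos n M k) *:%R (@kmulv M c i k)
    (@kmulv_linear M c i k).

Lemma kdiff_kmulv M c j (u : kos n M j) :
  kdiff f j (kmulv c j.+1 u) + kmulv c j (kdiff f j.-1 u) =
  (\sum_a c a * f a) *: u.
Proof.
rewrite /kmulv linear_sum -big_split /= scaler_suml; apply: eq_bigr => a _.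
by rewrite linearZ /= -scalerDr kdiff_kmul scalerA.
Qed.

Definition kmap M N (phi : {linear M -> N}) i (u : kos n M i) : kos n N i :=
  [ffun A => phi (u A)].

Lemma kmap_linear M N (phi : {linear M -> N}) i : linear (@kmap M N phi i).
Proof. by move=> r u v; apply/ffunP => A; rewrite !ffunE linearP. Qed.

HB.instance Definition _ M N (phi : {linear M -> N}) i :=
  GRing.isLinear.Build R (kos n M i) (kos n N i) *:%R (@kmap M N phi i)
    (@kmap_linear M N phi i).

Lemma kdiff_kmap M N (phi : {linear M -> N}) i k (u : kos n M i) :
  kdiff f k (kmap phi u) = kmap phi (kdiff f k u).
Proof.
rewrite /kdiff linear_sum; apply: eq_bigr => A _.
rewrite linear_sum; apply: eq_bigr => a _; apply/ffunP => B; rewrite !ffunE.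
by case: ifP; rewrite ?linear0 // linearZ.
Qed.

End KoszulHomotopy.

(** Allows an isomorphism to be given on chains without choosing lifts linearly: by linearity, the
    conditions at 0 make the relation single-valued in both directions. *)
Lemma lmod_iso_rel (R : pzRingType) (M N : lmodType R) (rel : M -> N -> Prop) :
  (forall r x x' y y', rel x y -> rel x' y' ->
     rel (r *: x + x') (r *: y + y')) ->
  (forall x, exists y, rel x y) -> (forall y, exists x, rel x y) ->
  (forall y, rel 0 y -> y = 0) -> (forall x, rel x 0 -> x = 0) ->
  lmod_iso M N.
Proof.
move=> relP relL relR rel0l rel0r.
have relBl x y y' : rel x y -> rel x y' -> y = y'.
  move=> xy xy'; have := relP (-1) _ _ _ _ xy xy'.
  by rewrite scaleN1r addNr scaleN1r addrC => /rel0l /eqP; rewrite subr_eq0 => /eqP.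
have relBr x x' y : rel x y -> rel x' y -> x = x'.
  move=> xy xy'; have := relP (-1) _ _ _ _ xy xy'.
  by rewrite !scaleN1r addNr addrC => /rel0r /eqP; rewrite subr_eq0 => /eqP.
have [phi phiP] := choice relL; have [psi psiP] := choice relR.
have phi_lin : linear phi.
  by move=> r x x'; apply: (relBl (r *: x + x')); [exact: phiP | exact: relP].
pose phiL := HB.pack_for {linear M -> N} phi
  (GRing.isLinear.Build R M N *:%R phi phi_lin).
exists phiL; exists psi => x /=.
  by apply: (relBr _ _ (phi x)); [exact: psiP | exact: phiP].
by apply: (relBl (psi x)); [exact: phiP | exact: psiP].
Qed.

Lemma lmod_iso_trans (R : pzRingType) (M N P : lmodType R) :
  lmod_iso M N -> lmod_iso N P -> lmod_iso M P.
Proof.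
move=> [phi phi_bij] [psi psi_bij].
by exists (psi \o phi : {linear M -> P}); exact: bij_comp.
Qed.

(** * Homology classes through representing cycles *)

Section Representatives.
Variables (R : pzRingType) (U V W : lmodType R).
Variables (d : {linear U -> V}) (d' : {linear V -> W}).
Implicit Types (z : homology d d') (u : U) (v : V).

Definition represents z v :=
  exists2 c : cycles d', val c = v & Defs.mpi (@boundaryp _ _ _ _ d d') c = z.

Lemma represents_cycle z v : represents z v -> d' v = 0.
Proof. by case=> c <- _; apply/eqP; exact: (valP c). Qed.

Lemma represents_repr z : exists v, represents z v.
Proof. by have [c cz] := mpi_surj z; exists (val c), c. Qed.

Lemma represents_class v : d' v = 0 -> exists z, represents z v.
Proof.
move=> dv; have vc : v \in cyclep d' by apply/eqP.
by exists (Defs.mpi _ (Cycle vc)), (Cycle vc).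
Qed.

Lemma represents_linear r z z' v v' : represents z v -> represents z' v' ->
  represents (r *: z + z') (r *: v + v').
Proof.
move=> [c <- <-] [c' <- <-]; exists (r *: c + c'); first exact: linearP.
exact: linearP.
Qed.

Lemma represents0P z v : represents z v -> z = 0 <-> exists u, v = d u.
Proof.
case=> c <- <-; split=> [/eqP|[u cu]].
  by rewrite -(raddf0 (Defs.mpi (@boundaryp _ _ _ _ d d'))) mpi_eq subr0 => /asboolP.
apply/eqP; rewrite -(raddf0 (Defs.mpi (@boundaryp _ _ _ _ d d'))) mpi_eq subr0.
by apply/asboolP; exists u.
Qed.

Lemma represents_homologous z v v' u :
  represents z v -> v' = v + d u -> d' v' = 0 -> represents z v'.
Proof.
move=> zv vE /represents_class[z' z'v']; suff -> : z = z' by [].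
have := represents_linear (-1) zv z'v'.
rewrite vE !scaleN1r addKr => zd.
have /(represents0P zd)/eqP : exists u0, d u = d u0 by exists u.
by rewrite addrC subr_eq0 => /eqP.
Qed.

End Representatives.

(* Coordinates, which reduce identities in a module to [ring]. *)
Lemma lincomb5 (R : comNzRingType) (V : lmodType R) (v0 v1 v2 v3 v4 : V) :
  exists L : R -> R -> R -> R -> R -> V,
  [/\ forall a0 a1 a2 a3 a4 b0 b1 b2 b3 b4,
       L a0 a1 a2 a3 a4 + L b0 b1 b2 b3 b4 =
       L (a0 + b0) (a1 + b1) (a2 + b2) (a3 + b3) (a4 + b4),
     forall a0 a1 a2 a3 a4,
       - L a0 a1 a2 a3 a4 = L (- a0) (- a1) (- a2) (- a3) (- a4),
     forall r a0 a1 a2 a3 a4, r *: L a0 a1 a2 a3 a4 =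
       L (r * a0) (r * a1) (r * a2) (r * a3) (r * a4) &
     [/\ v0 = L 1 0 0 0 0, v1 = L 0 1 0 0 0, v2 = L 0 0 1 0 0,
        v3 = L 0 0 0 1 0 & v4 = L 0 0 0 0 1]].
Proof.
exists (fun a0 a1 a2 a3 a4 =>
  a0 *: v0 + (a1 *: v1 + (a2 *: v2 + (a3 *: v3 + a4 *: v4)))); split.
- move=> a0 a1 a2 a3 a4 b0 b1 b2 b3 b4.
  by rewrite !scalerDl; do 3!(rewrite addrACA; congr (_ + _)); rewrite addrACA.
- by move=> a0 a1 a2 a3 a4; rewrite !opprD !scaleNr.
- by move=> r a0 a1 a2 a3 a4; rewrite !scalerDr !scalerA.
- by split; rewrite !scale0r scale1r ?addr0 ?add0r.
Qed.

(** * Koszul homology of M/yM when y is replaced by an associate modulo (f) *)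

Section ChangeOfDivisor.
Variables (R : comNzRingType) (n : nat) (f : 'I_n -> R) (M N N' : lmodType R).
Variables (y y' w w' : R) (c t : 'I_n -> R).
Variables (p : {linear M -> N}) (p' : {linear M -> N'}).
Hypothesis p_surj : forall x, exists x0, p x0 = x.
Hypothesis p'_surj : forall x, exists x0, p' x0 = x.
Hypothesis p_ker : forall x, p x = 0 <-> exists e, x = y *: e.
Hypothesis p'_ker : forall x, p' x = 0 <-> exists e, x = y' *: e.
Hypothesis y_reg : forall x : M, y *: x = 0 -> x = 0.
Hypothesis y'_reg : forall x : M, y' *: x = 0 -> x = 0.
Hypothesis y'E : y' = w * y + \sum_a c a * f a.
Hypothesis ww'E : w * w' = 1 - \sum_a t a * f a.

Lemma kmap_surj (A B : lmodType R) (phi : {linear A -> B}) i :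
  (forall x, exists x0, phi x0 = x) ->
  forall u : kos n B i, exists u0, kmap phi u0 = u.
Proof.
move=> /choice[psi psiK] u; exists [ffun I => psi (u I)].
by apply/ffunP => I; rewrite !ffunE.
Qed.

Lemma kmap_ker (A B : lmodType R) (phi : {linear A -> B}) r i :
  (forall x, phi x = 0 <-> exists e, x = r *: e) ->
  forall u : kos n A i, kmap phi u = 0 <-> exists e, u = r *: e.
Proof.
move=> kerE u; split=> [u0|[e ->]].
  have /choice[e eE] (I : isub n i) : exists e, u I = r *: e.
    by apply/kerE; have /ffunP/(_ I) := u0; rewrite !ffunE.
  by exists [ffun I => e I]; apply/ffunP => I; rewrite !ffunE.
apply/ffunP => I; rewrite !ffunE; apply/kerE.
by exists (e I).
Qed.

Lemma kos_reg r i : (forall x : M, r *: x = 0 -> x = 0) ->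
  forall u : kos n M i, r *: u = 0 -> u = 0.
Proof.
move=> r_reg u /ffunP u0; apply/ffunP => I; have := u0 I.
by rewrite !ffunE => /r_reg.
Qed.

(** Applying the differential to [r *: v] gives 0, so [v] is a cycle by regularity and the homotopy
    formula loses its second term. *)
Lemma kdiff_kmulv_quot r b j (u : kos n M j) (v : kos n M j.-1) :
  (forall x : M, r *: x = 0 -> x = 0) -> kdiff f j.-1 u = r *: v ->
  kdiff f j.-1 (kmulv b j v) = (\sum_a b a * f a) *: v.
Proof.
move=> r_reg; case: j u v => [|j] u v du.
  (* In degree 0, [v] sits in degree 0 instead of -1; the differential of [u] is then 0, which
     forces [v = 0]. *)
  suff -> : v = 0 by rewrite scaler0 !linear0.
  apply: (kos_reg r_reg); rewrite -du /kdiff big1 // => A _.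
  by have /eqP/cards0_eq -> := valP A; rewrite big_set0.
have dv : kdiff f j.-1 v = 0.
  by apply: (kos_reg r_reg); rewrite -linearZ /= -du kdiffK.
by have := kdiff_kmulv f b v; rewrite dv linear0 addr0.
Qed.

(* H_j(f; M/yM) is the homology of the cone of y on K(f; M): a class is given
   by u with d u = y v. Changing y to w y is (u, v) |-> (w u, v), and adding
   s = \sum_a c_a f_a to it is (u, v) |-> (u + c /\ v, v). *)
Definition change_rel j (z : koszulH f N j) (z' : koszulH f N' j) :=
  exists u v, [/\ kdiff f j.-1 u = y *: v, represents z (kmap p u) &
    represents z' (kmap p' (w *: u + kmulv c j v))].

(** [y'E] and [ww'E] say that [y] and [y'] are associates modulo (f), with unit [w] and inverse
    [w']. The coefficients [c] give the homotopy correcting [w * y] to [y'], and [t] the one between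
    [w * w'] and 1. *)
Lemma koszulH_change j : lmod_iso (koszulH f N j) (koszulH f N' j).
Proof.
pose s := \sum_a c a * f a; pose tt := \sum_a t a * f a.
have y's : y' = w * y + s := y'E; have wwt : w * w' = 1 - tt := ww'E.
have hs u v := @kdiff_kmulv_quot y c j u v y_reg.
have lift (u : kos n M j) v : kdiff f j.-1 u = y *: v ->
    kdiff f j.-1 (w *: u + kmulv c j v) = y' *: v.
  move=> du; rewrite linearD linearZ /= du (hs _ _ du) scalerA -scalerDl.
  by rewrite y'E.
have cyc (B : lmodType R) (phi : {linear M -> B}) r (u : kos n M j) v :
    (forall x, phi x = 0 <-> exists e, x = r *: e) ->
    kdiff f j.-1 u = r *: v -> kdiff f j.-1 (kmap phi u) = 0.
  move=> kerE du; rewrite kdiff_kmap; apply/(kmap_ker kerE).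
  by exists v.
have div (B : lmodType R) (phi : {linear M -> B}) r (u : kos n M j) :
    (forall x, phi x = 0 <-> exists e, x = r *: e) ->
    kdiff f j.-1 (kmap phi u) = 0 -> exists v, kdiff f j.-1 u = r *: v.
  by move=> kerE; rewrite kdiff_kmap => /(kmap_ker kerE).
have bdry (B : lmodType R) (phi : {linear M -> B}) r (u : kos n M j) :
    (forall x, exists x0, phi x0 = x) ->
    (forall x, phi x = 0 <-> exists e, x = r *: e) ->
    (exists b : kos n B j.+1, kmap phi u = kdiff f j b) ->
    exists b e, u = kdiff f j (b : kos n M j.+1) + r *: e.
  move=> surj kerE [b ub]; have [b0 b0E] := kmap_surj surj b.
  have /(kmap_ker kerE)[e eE] : kmap phi (u - kdiff f j b0) = 0.
    by rewrite linearB /= -kdiff_kmap b0E ub subrr.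
  by exists b0, e; rewrite -eE addrC subrK.
apply: (lmod_iso_rel (rel := @change_rel j)).
- move=> r z1 z2 z1' z2' [u1 [v1 [d1 r1 r1']]] [u2 [v2 [d2 r2 r2']]].
  exists (r *: u1 + u2), (r *: v1 + v2); split.
  + by rewrite [kdiff _ _ _]linearP /= d1 d2 scalerDr !scalerA mulrC.
  + by rewrite [kmap _ _]linearP; apply: represents_linear.
  + rewrite [kmulv _ _ _]linearP /= scalerDr scalerA mulrC -scalerA addrACA -scalerDr.
    rewrite [kmap _ _]linearP.
    exact: represents_linear.
- move=> z; have [u0 zu0] := represents_repr z.
  have [u uE] := kmap_surj p_surj u0; rewrite -uE in zu0.
  have [v du] := div _ _ _ _ p_ker (represents_cycle zu0).
  have [z' z'P] := represents_class (@kdiff _ _ f _ j.+1 j)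
    (cyc _ _ _ _ _ p'_ker (lift _ _ du)).
  by exists z', u, v.
- move=> z'; have [u0 zu0] := represents_repr z'.
  have [u uE] := kmap_surj p'_surj u0; rewrite -uE in zu0.
  have [v du] := div _ _ _ _ p'_ker (represents_cycle zu0).
  have hs' := @kdiff_kmulv_quot y' c j u v y'_reg du.
  have ht' := @kdiff_kmulv_quot y' t j u v y'_reg du.
  (* The naive inverse w'(u - c /\ v) has differential w w' y v, which is y v only up to the factor
     1 - [tt]; the term y (t /\ v) supplies the missing [tt]. *)
  pose u1 := w' *: u + y *: kmulv t j v - w' *: kmulv c j v.
  have du1 : kdiff f j.-1 u1 = y *: v.
    rewrite /u1 linearB linearD /= !linearZ /= du hs' ht' -/s -/tt.
    have [L [LD LN LZ [-> _ _ _ _]]] := lincomb5 v 0 0 0 0.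
    rewrite !(LZ, LN, LD); congr (L _ _ _ _ _); rewrite ?y's; ring: wwt.
  have [z zP] := represents_class (@kdiff _ _ f _ j.+1 j) (cyc _ _ _ _ _ p_ker du1).
  exists z, u1, v; split=> //.
  (* The homotopy [t] applied to c /\ v - u: its differential is exactly w u1 + c /\ v - u, already
     over [M]. *)
  pose b := kmulv t j.+1 (kmulv c j v) - kmulv t j.+1 u.
  apply: (represents_homologous (u := kmap p' b) zu0); last first.
    exact: cyc p'_ker (lift _ _ du1).
  rewrite /= kdiff_kmap -linearD /=; congr (kmap _ _).
  have E1 := kdiff_kmulv f t u; have E2 := kdiff_kmulv f t (kmulv c j v).
  rewrite -/tt du hs' -/s in E1 E2.
  rewrite /b [kdiff _ _ _]linearB /=.
  have -> : kdiff f j (kmulv t j.+1 u) = tt *: u - y' *: kmulv t j v.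
    by rewrite -E1 linearZ addrK.
  have -> : kdiff f j (kmulv t j.+1 (kmulv c j v)) =
      tt *: kmulv c j v - s *: kmulv t j v.
    by rewrite -E2 linearZ addrK.
  rewrite /u1; move: (kmulv t j v) (kmulv c j v) => T C.
  have [L [LD LN LZ [-> -> -> _ _]]] := lincomb5 u T C 0 0.
  rewrite !(LZ, LN, LD); congr (L _ _ _ _ _); rewrite ?y's; ring: wwt.
- move=> z' [u [v [du zu z'u]]].
  have [b [e uE]] := bdry _ _ _ _ p_surj p_ker (iffLR (represents0P zu) erefl).
  have vE : v = kdiff f j.-1 e.
    apply/eqP; rewrite -subr_eq0; apply/eqP/(kos_reg y_reg).
    by rewrite scalerBr -du uE linearD linearZ /= kdiffK // add0r subrr.
  apply/(represents0P z'u).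
  (* With u = db + ye and v = de, w u + c /\ v equals d(w b - c /\ e) + y' e, since c /\ de = s e -
     d(c /\ e). *)
  exists (kmap p' (w *: b - kmulv c j.+1 e)); rewrite /= kdiff_kmap.
  apply/eqP; rewrite -subr_eq0 -linearB; apply/eqP/(kmap_ker p'_ker).
  exists e; rewrite vE uE linearB linearZ /=.
  have -> : kmulv c j (kdiff f j.-1 e) = s *: e - kdiff f j (kmulv c j.+1 e).
    by rewrite -kdiff_kmulv addrAC subrr add0r.
  move: (kdiff f j b) (kdiff f j (kmulv c j.+1 e)) => B H.
  have [L [LD LN LZ [-> -> -> _ _]]] := lincomb5 B H e 0 0.
  rewrite !(LZ, LN, LD); congr (L _ _ _ _ _); rewrite ?y's; ring.
- move=> z [u [v [du zu z'u]]].
  have [b [e uE]] := bdry _ _ _ _ p'_surj p'_ker (iffLR (represents0P z'u) erefl).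
  have vE : v = kdiff f j.-1 e.
    apply/eqP; rewrite -subr_eq0; apply/eqP/(kos_reg y'_reg).
    by rewrite scalerBr -(lift _ _ du) uE linearD linearZ /= kdiffK // add0r subrr.
  apply/(represents0P zu).
  (* Multiplying w u + c /\ v = db + y' e by w' recovers (1 - [tt]) u; the boundary of t /\ u
     restores [tt] u, up to multiples of y. *)
  exists (kmap p (kmulv t j.+1 u + w' *: b + w' *: kmulv c j.+1 e)).
  rewrite /= kdiff_kmap.
  apply/eqP; rewrite -subr_eq0 -linearB; apply/eqP/(kmap_ker p_ker).
  exists (kmulv t j v + (w * w') *: e); rewrite !linearD !linearZ /=.
  have -> : kdiff f j (kmulv t j.+1 u) = tt *: u - y *: kmulv t j v.
    by rewrite -kdiff_kmulv du linearZ addrK.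
  have CE : kmulv c j v = s *: e - kdiff f j (kmulv c j.+1 e).
    by rewrite vE -kdiff_kmulv addrAC subrr add0r.
  have -> : kdiff f j b = w *: u + kmulv c j v - y' *: e by rewrite uE addrK.
  rewrite CE; move: (kmulv t j v) (kdiff f j (kmulv c j.+1 e)) => T H.
  have [L [LD LN LZ [-> -> -> -> _]]] := lincomb5 u T H e 0.
  rewrite !(LZ, LN, LD); congr (L _ _ _ _ _); rewrite ?y's; ring: wwt.
Qed.

End ChangeOfDivisor.

(** * Finiteness of quotients by regular sequences *)

Section IdealMembership.
Variables (R : comPzRingType) (n : nat).
Implicit Types (P Q : pred 'I_n) (f : 'I_n -> R).

Lemma mem_ideal_gen P f i : P i -> (f i : R^o) \in ideal_gen P f.
Proof.
move=> Pi; apply/asboolP; exists (fun j => (j == i)%:R).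
rewrite (bigD1 i) //= eqxx mul1r big1 ?addr0 // => j /andP[_ /negPf ->].
by rewrite mul0r.
Qed.

Lemma ideal_genMl (I : submodClosed R^o) r (x : R) : x \in I -> r * x \in I.
Proof. exact: (@rpredZ _ _ I r x). Qed.

Lemma ideal_genB (I : submodClosed R^o) (x y : R) :
  x \in I -> y \in I -> x - y \in I.
Proof.
by move=> Ix Iy; rewrite -mulN1r; apply: (@rpredD _ I) => //; apply: ideal_genMl.
Qed.

Lemma ideal_gen_sub P f (I : submodClosed R^o) :
  (forall i, P i -> f i \in I) -> {subset ideal_gen P f <= I}.
Proof.
move=> fI x /asboolP[c ->]; elim/big_ind: _ => [|y z|i Pi].
- exact: (@rpred0 _ I).
- exact: (@rpredD _ I).
- exact/ideal_genMl/fI.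
Qed.

Lemma ideal_gen_subset P Q f : (forall i, P i -> Q i) ->
  {subset ideal_gen P f <= ideal_gen Q f}.
Proof. by move=> PQ; apply: ideal_gen_sub => i /PQ; exact: mem_ideal_gen. Qed.

Lemma rpi_eq0 (I : submodClosed R^o) (x : R) : rpi I x = 0 <-> x \in I.
Proof.
rewrite -(raddf0 (rpi I)); split=> [/eqP|xI]; last apply/eqP.
  by rewrite mpi_eq subr0.
by rewrite mpi_eq subr0.
Qed.

Lemma nonzerodivisor_rpi (I : submodClosed R^o) (a : R) :
  nonzerodivisor (rpi I a) <-> forall x, a * x \in I -> x \in I.
Proof.
split=> [a_reg x axI|a_reg x].
  by apply/rpi_eq0/a_reg; rewrite -rmorphM; apply/rpi_eq0.
have [r <-] := rpi_surj x; rewrite -rmorphM => /rpi_eq0/a_reg ?.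
exact/rpi_eq0.
Qed.

End IdealMembership.

Lemma leq_wexp2r e m n : (m <= n)%N -> (m ^ e <= n ^ e)%N.
Proof. by case: e => [|e] mn; rewrite ?expn0 ?leq_exp2r. Qed.

(** * Boxes of exponents and the growth of quotients *)

Section Boxes.
Variables (D : nat) (A : comNzRingType).
Local Notation R := (laurent D A).
Implicit Types (x y : R) (n : nat).

Definition box n x := forall (k : {ffun 'I_D -> int}) b,
  x@_k != 0 -> (absz (k b) <= n)%N.

Lemma box_exists x : exists n, box n x.
Proof.
exists (\max_(k <- msupp x) \max_b absz (k b))%N => k b xk.
have kx : k \in msupp x by rewrite -mcoeff_neq0.
apply: leq_trans (leq_bigmax_seq k _ _) => //.
exact: (leq_bigmax b).
Qed.

Lemma box_le m n x : (m <= n)%N -> box m x -> box n x.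
Proof. by move=> mn mx k b /(mx k b) /leq_trans ->. Qed.

Lemma box0 n : box n 0.
Proof. by move=> k b; rewrite mcoeff0 eqxx. Qed.

Lemma boxD n x y : box n x -> box n y -> box n (x + y).
Proof.
move=> nx ny k b; rewrite mcoeffD => xyk.
have [xk|/(nx k b)//] := eqVneq x@_k 0; apply: (ny k b).
by apply: contraNneq xyk => ->; rewrite xk addr0.
Qed.

Lemma box_sum n (I : Type) (s : seq I) (F : I -> R) :
  (forall i, box n (F i)) -> box n (\sum_(i <- s) F i).
Proof.
by move=> nF; elim/big_ind: _ => // [|x y]; [exact: box0 | exact: boxD].
Qed.

Lemma boxU n (a : A) (k : {ffun 'I_D -> int}) :
  (forall b, absz (k b) <= n)%N -> box n (<< a *g k >> : R).
Proof.
move=> nk l b; rewrite mcoeffU; case: (k =P l) => [<- _|]; first exact: nk.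
by rewrite mulr0n eqxx.
Qed.

Lemma boxM m n x y : box m x -> box n y -> box (m + n) (x * y).
Proof.
move=> mx ny; rewrite -[x * y]/(galg_mul x y) /galg_mul big_seq.
elim/big_ind: _ => [||k kx]; [exact: box0 | exact: boxD | rewrite big_seq].
elim/big_ind: _ => [||l ly]; [exact: box0 | exact: boxD | apply: boxU => b].
have absD (i j : int) : (absz i <= m -> absz j <= n -> absz (i + j)%R <= m + n)%N by lia.
by rewrite ffunE; apply: absD; [apply: mx | apply: ny]; rewrite mcoeff_neq0.
Qed.

Lemma boxX n x i : box n x -> box (i * n) (x ^+ i).
Proof.
move=> nx; elim: i => [|i IH]; last by rewrite exprS mulSn; apply: boxM.
by rewrite expr0; apply: (@boxU 0 1 0) => b; rewrite ffunE.
Qed.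

(* The image of [box n] in R / I has at most 2 ^ O(n ^ d) elements: T indexes
   representatives of distinct classes. *)
Definition growth (I : {pred R^o}) d := exists C, forall n (T : finType) (w : T -> R),
  (forall t, box n (w t)) -> (forall t t', w t - w t' \in I -> t = t') ->
  (#|T| <= 2 ^ (C * n.+1 ^ d))%N.

(** An element of the box has (2n+1)^D coefficients, each with at most q values. The constant comes
    from q <= 2^q and (2n+1)^D <= 2^D (n+1)^D. *)
Lemma growth_box (q : nat) (e : A -> 'I_q) (I : submodClosed R^o) :
  injective e -> growth I D.
Proof.
move=> e_inj; exists (q * 2 ^ D)%N => n T w nw w_sep.
have absz_ge (z : int) : (absz z <= n)%N -> 0 <= z + n%:Z by lia.
pose key (c : {ffun 'I_D -> 'I_n.*2.+1}) : {ffun 'I_D -> int} :=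
  [ffun b => (c b)%:Z - n%:Z].
pose code t : {ffun {ffun 'I_D -> 'I_n.*2.+1} -> 'I_q} :=
  [ffun c => e (w t)@_(key c)].
have code_inj : injective code.
  move=> t t' tt'; apply: w_sep; suff -> : w t = w t'.
    by rewrite subrr; apply: (@rpred0 _ I).
  apply/malgP => k; have [kn|/existsP[b kb]] := boolP [forall b, absz (k b) <= n]%N.
    have {}kn b : (absz (k b) <= n)%N by apply: (forallP kn).
    have bnd b : (absz (k b + n%:Z)%R < n.*2.+1)%N by have := kn b; lia.
    have := congr1 (fun g : {ffun _} => g [ffun b => Ordinal (bnd b)]) tt'.
    rewrite !ffunE => /e_inj; suff -> : key [ffun b => Ordinal (bnd b)] = k by [].
    apply/ffunP => b; rewrite !ffunE /= gez0_abs ?addrK //.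
    exact: absz_ge.
  have z s : (w s)@_k = 0.
    by apply/eqP; apply: contraNT kb => /(nw s k b).
  by rewrite !z.
have := leq_card code code_inj; rewrite !card_ffun !card_ord => /leq_trans; apply.
have q2 : (q <= 2 ^ q)%N by apply/ltnW/ltn_expl.
apply: (leq_trans (leq_wexp2r _ q2)); rewrite -expnM leq_exp2l // -mulnA leq_mul2l.
apply/orP; right; rewrite -expnMn; apply: leq_wexp2r; lia.
Qed.

(* With N = n + 1 representatives w of distinct classes mod (I, f), the sums
   \sum_(i < N) f^i w_i are pairwise distinct mod I: reduce mod f, cancel f, and
   repeat. *)
Lemma growth_regular (I J : submodClosed R^o) (f : R) d :
  (forall x, f * x \in I -> x \in I) -> {subset I <= J} -> f \in J ->
  growth I d.+1 -> growth J d.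
Proof.
move=> f_reg IJ Jf [C bound]; have [c cf] := box_exists f.
(* The sums [W] lie in the box of size n(c+1), so |T|^(n+1) is at most 2^(C ((c+1)(n+1))^(d+1));
   taking (n+1)-th roots lowers the exponent of n+1 to d. *)
exists (C * c.+1 ^ d.+1)%N => n T w nw w_sep.
pose W (phi : {ffun 'I_n.+1 -> T}) : R := \sum_(i < n.+1) f ^+ i * w (phi i).
have boxW phi : box (n * c + n) (W phi).
  apply: box_sum => i; apply: boxM; last exact: nw.
  apply: (@box_le (i * c)); last exact: boxX.
  by rewrite leq_mul2r -ltnS ltn_ord orbT.
have digits N (z : nat -> R) : (forall i, (i < N)%N -> z i \in J -> z i = 0) ->
    \sum_(i < N) f ^+ i * z i \in I -> forall i, (i < N)%N -> z i = 0.
  elim: N z => // N IH z zJ; rewrite big_ord_recl expr0 mul1r.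
  have -> : \sum_(i < N) f ^+ lift ord0 i * z (lift ord0 i) =
      f * \sum_(i < N) f ^+ i * z i.+1.
    by rewrite mulr_sumr; apply: eq_bigr => i _; rewrite exprS mulrA.
  move=> zI; have z0 : z 0%N = 0.
    apply: zJ => //; rewrite -(addrK (f * \sum_(i < N) f ^+ i * z i.+1) (z 0%N)).
    apply: (ideal_genB (IJ _ zI)); rewrite mulrC; exact: ideal_genMl Jf.
  move: zI; rewrite z0 add0r => /f_reg zI [|i] // iN.
  by apply: (IH (fun i => z i.+1)) => // l lN; apply: zJ.
have W_sep phi psi : W phi - W psi \in I -> phi = psi.
  move=> phipsi; apply/ffunP => i; apply: (w_sep).
  pose z l := w (phi (inord l)) - w (psi (inord l)).
  have := @digits n.+1 z _ _ i (ltn_ord i).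
  rewrite /z inord_val => -> //; first exact: (@rpred0 _ J).
    by move=> l _ /w_sep ->; rewrite subrr.
  suff -> : \sum_(l < n.+1) f ^+ l * z l = W phi - W psi by [].
  by rewrite /W -sumrB; apply: eq_bigr => l _; rewrite /z inord_val mulrBr.
have := bound _ _ _ boxW W_sep; rewrite card_ffun card_ord => TC.
rewrite -(leq_exp2r _ _ (ltn0Sn n)); apply: leq_trans TC _.
rewrite -expnM leq_exp2l // -!mulnA leq_mul2l -expnSr -expnMn; apply/orP; right.
by apply: leq_wexp2r; rewrite mulnS mulSn; lia.
Qed.

(** With exponent 0 the bound 2^C does not depend on the box, and any finite set of representatives
    fits into one box. *)
Lemma finite_rquot (I : submodClosed R^o) : growth I 0 ->
  finite_set [set: rquot I].
Proof.
move=> [C bound]; apply: contrapT => /(@infinite_set_fset _ _ (2 ^ C).+1)[B _ Bbig].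
pose w (t : B) : R := mrepr (val t : rquot I).
have [n nw] := choice (fun t => box_exists (w t)).
have := bound (\max_t n t)%N B w _ _; rewrite -cardfE expn0 muln1.
rewrite leqNgt Bbig => /(_ _ _)/negP; apply=> // [t|t t'].
  exact/(box_le _ (nw t))/leq_bigmax.
by rewrite /w -(mpi_eq I) !mreprK => /eqP/val_inj.
Qed.

End Boxes.

(** Each further element of the sequence lowers the growth exponent from D - i to D - i - 1. This
    serves both for R/(f) and for R_L. *)
Lemma finite_rmod_regular D (A : comNzRingType) q (e : A -> 'I_q)
    (f : 'I_D -> laurent D A) :
  injective e -> regular_seq f -> finite_set [set: rmod f].
Proof.
move=> e_inj f_reg; apply: finite_rquot.
pose I i := ideal_gen [pred j : 'I_D | (j < i)%N] f.
have gI i : (i <= D)%N -> growth (I i) (D - i).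
  elim: i => [_|i IH iD]; first by rewrite subn0; apply: growth_box e_inj.
  pose i' := Ordinal iD; apply: (@growth_regular _ _ (I i) (I i.+1) (f i')).
  - exact/nonzerodivisor_rpi/(f_reg i').
  - by apply: ideal_gen_subset => j /= /leqW.
  - by apply: mem_ideal_gen => /=.
  - by rewrite -subSn // subSS; apply/IH/ltnW.
have [C bound] := gI D (leqnn D); exists C => n T w nw w_sep.
rewrite -{2}(subnn D); apply: bound nw _ => t t' /ideal_gen_subset tt'.
exact/w_sep/tt'.
Qed.

(** * Regularity of x_a^l - 1 *)

Section MonomialMaps.
Variables (G : zmodType) (A : comNzRingType).
Implicit Types (nu : G -> G) (x y : galg G A).

(** [nu] is not assumed additive, because it will be the reduction of exponents to remainders; the
    map is additive but in general not multiplicative. *)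
Definition galg_map nu x : galg G A :=
  \sum_(k <- msupp x) << x@_k *g nu k >>.

Lemma galg_mapw nu (d : {fset G}) x : (msupp x `<=` d)%fset ->
  galg_map nu x = \sum_(k <- d) << x@_k *g nu k >>.
Proof.
move=> le_d; rewrite /galg_map (big_fset_incl _ le_d) //= => k _ /mcoeff_outdom ->.
by rewrite monalgU0.
Qed.

Lemma galg_mapD nu x y : galg_map nu (x + y) = galg_map nu x + galg_map nu y.
Proof.
rewrite (galg_mapw nu (msuppD_le x y)) (galg_mapw nu (fsubsetUl (msupp x) (msupp y))).
rewrite (galg_mapw nu (fsubsetUr (msupp x) (msupp y))) -big_split /=.
by apply: eq_bigr => k _; rewrite mcoeffD monalgUD.
Qed.

Lemma galg_map0 nu : galg_map nu 0 = 0.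
Proof. by rewrite /galg_map msupp0 big_seq_fset0. Qed.

Lemma galg_mapB nu x y : galg_map nu (x - y) = galg_map nu x - galg_map nu y.
Proof. by apply/eqP; rewrite eq_sym subr_eq -galg_mapD subrK. Qed.

Lemma galg_map_sum nu (I : Type) (s : seq I) (P : pred I) (F : I -> galg G A) :
  galg_map nu (\sum_(i <- s | P i) F i) = \sum_(i <- s | P i) galg_map nu (F i).
Proof. exact: (big_morph (galg_map nu) (galg_mapD nu) (galg_map0 nu)). Qed.

Lemma galg_mapU nu (a : A) k : galg_map nu << a *g k >> = << a *g nu k >>.
Proof. by rewrite (galg_mapw nu msuppU_le) big_seq_fset1 mcoeffUU. Qed.

Lemma galg_UE (a : A) (k l : G) :
  (<< a *g k + l >> : galg G A) =
    (<< a *g k >> : galg G A) * (<< l >> : galg G A).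
Proof. by rewrite -[RHS]/(galg_mul _ _) galg_mulUU mulr1. Qed.

Lemma galg_map_shift nu k0 k1 x : (forall k, nu (k0 + k) = k1 + nu k) ->
  galg_map nu ((<< k0 >> : galg G A) * x) = (<< k1 >> : galg G A) * galg_map nu x.
Proof.
move=> nuD; rewrite [in LHS](galgE x) mulr_sumr galg_map_sum mulr_sumr.
apply: eq_bigr => k _; rewrite -[X in galg_map _ X]/(galg_mul _ _).
by rewrite -[RHS]/(galg_mul _ _) !galg_mulUU galg_mapU nuD.
Qed.

Lemma mcoeff_shift k0 k x : ((<< k0 >> : galg G A) * x)@_k = x@_(k - k0).
Proof.
rewrite [in LHS](galgE x) mulr_sumr [in RHS](galgE x) !raddf_sum /=.
apply: eq_bigr => l _; rewrite -[X in X@__]/(galg_mul _ _) galg_mulUU mul1r.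
by rewrite !mcoeffU eq_sym addrC -subr_eq eq_sym.
Qed.

End MonomialMaps.

Section LaurentPowers.
Variables (D : nat) (A : comNzRingType).
Local Notation R := (laurent D A).
Local Notation mon k := (<< k >> : R).
Implicit Types (x : R) (a b : 'I_D) (L : 'I_D -> nat).

Definition axis a (z : int) : {ffun 'I_D -> int} :=
  [ffun b => if b == a then z else 0].

Lemma axisD a z z' : axis a (z + z') = axis a z + axis a z'.
Proof. by apply/ffunP => b; rewrite !ffunE; case: ifP; rewrite ?addr0. Qed.

Lemma axisN a z : axis a (- z) = - axis a z.
Proof. by apply/ffunP => b; rewrite !ffunE; case: ifP; rewrite ?oppr0. Qed.

Lemma lvarX a l : lvar A a ^+ l = mon (axis a l%:Z).
Proof.
elim: l => [|l IH].
  rewrite expr0 -[LHS]/(<< 0 >> : R); congr (<< _ >>).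
  by apply/ffunP => b; rewrite !ffunE if_same.
rewrite exprS IH -addn1 addnC PoszD axisD galg_UE /lvar; congr (_ * _); congr mkmalgU.
by apply/ffunP => b; rewrite !ffunE; case: eqP.
Qed.

Definition powers L a : R := lvar A a ^+ L a - 1.

(** The coefficients of such an [x] are invariant under translation by l along axis [a], which a
    nonzero finite support cannot be. *)
Lemma laurent_pow_reg a l x : (0 < l)%N -> (lvar A a ^+ l - 1) * x = 0 -> x = 0.
Proof.
move=> l0; rewrite mulrBl mul1r lvarX => /eqP; rewrite subr_eq0 => /eqP xE.
have step k : x@_(k - axis a l%:Z) = x@_k by rewrite -mcoeff_shift xE.
have steps i k : x@_(k - axis a (i * l)%:Z) = x@_k.
  elim: i => [|i IH].
    by congr (x@__); apply/ffunP => b; rewrite !ffunE if_same subr0.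
  by rewrite mulSn addnC PoszD axisD opprD addrA step IH.
apply/malgP => k; rewrite mcoeff0; apply/eqP; apply: contraT => xk.
have [n nx] := box_exists x.
(* Large enough that shifting [k a] down by i l >= i leaves the interval [-n, n]. *)
pose i := (n + absz (k a)).+1.
have := nx (k - axis a (i * l)%:Z) a; rewrite steps => /(_ xk).
rewrite !ffunE eqxx; suff /negP : ~~ (absz (k a - (i * l)%:Z)%R <= n)%N by [].
have il : (i <= i * l)%N by rewrite leq_pmulr.
by move: il; rewrite /i; move: (k a : int) => z; move: (_ * l)%N => m; lia.
Qed.

Section NormalForm.
Variables (P : pred 'I_D) (L : 'I_D -> nat).

(** Gives a normal form modulo the x_b^L_b - 1 with [P b]: [sub_reduce_mem] and [reduce_mem] show
    that the induced map has exactly this ideal as kernel. *)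
Definition reduce_exp (k : {ffun 'I_D -> int}) : {ffun 'I_D -> int} :=
  [ffun b => if P b then (k b %% L b)%Z else k b].

Local Notation I := (ideal_gen P (powers L)).

(** The class of x^k is multiplicative in k and trivial on multiples of L_b along axis b, and [k]
    differs from its reduction by a sum of these. *)
Lemma rpi_mon_reduce k : rpi I (mon k) = rpi I (mon (reduce_exp k)).
Proof.
pose chi k := rpi I (mon k).
have chiD k1 k2 : chi (k1 + k2) = chi k1 * chi k2 by rewrite /chi galg_UE rmorphM.
have chi0 : chi 0 = 1 by rewrite /chi -[mon 0]/(1 : R) rmorph1.
have chiN k1 : chi k1 = 1 -> chi (- k1) = 1.
  by move=> k1E; have := chiD k1 (- k1); rewrite subrr chi0 k1E mul1r.
have chi_nat b (q : nat) : P b -> chi (axis b (q * L b)%:Z) = 1.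
  move=> Pb; elim: q => [|q IH].
    by rewrite -chi0; congr chi; apply/ffunP => c; rewrite !ffunE if_same.
  rewrite mulSn PoszD axisD chiD IH mulr1.
  apply/eqP; rewrite -subr_eq0 /chi -(rmorph1 (rpi I)) -rmorphB -lvarX.
  by apply/eqP/rpi_eq0/(mem_ideal_gen (powers L)).
have chi_int b (q : int) : P b -> chi (axis b (q * (L b)%:Z)) = 1.
  move=> Pb; case: (intP q) => [|n|n]; first by rewrite mul0r; apply: (chi_nat b 0).
    by rewrite -PoszM; apply: chi_nat.
  by rewrite mulNr axisN; apply: chiN; rewrite -PoszM; apply: chi_nat.
pose e b : int := if P b then (k b %/ L b)%Z * (L b)%:Z else 0.
have kE : k = reduce_exp k + \sum_b axis b (e b).
  apply/ffunP => b; rewrite !ffunE sum_ffunE (bigD1 b) //= big1 => [|c cb].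
    rewrite !ffunE eqxx addr0 /e; case: ifP => _; last by rewrite addr0.
    by rewrite addrC -divz_eq.
  by rewrite ffunE eq_sym (negPf cb).
rewrite -/(chi _) {1}kE chiD; suff -> : chi (\sum_b axis b (e b)) = 1 by rewrite mulr1.
elim/big_ind: _ => [//|k1 k2 k1E k2E|b _]; first by rewrite chiD k1E k2E mulr1.
rewrite /e; case: ifP => [/chi_int//|_].
by rewrite -chi0; congr chi; apply/ffunP => c; rewrite !ffunE if_same.
Qed.

Lemma sub_reduce_mem x : x - galg_map reduce_exp x \in I.
Proof.
rewrite {1}[x]galgE /galg_map -sumrB; elim/big_ind: _ => [|y z|k _].
- exact: (@rpred0 _ I).
- exact: (@rpredD _ I).
have monE l : << x@_k *g l >> = (<< x@_k *g 0 >> : R) * mon l.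
  by rewrite -galg_UE add0r.
rewrite (monE k) (monE (reduce_exp k)) -mulrBr; apply: ideal_genMl.
by rewrite -(mpi_eq I); apply/eqP; apply: rpi_mon_reduce.
Qed.

Lemma reduce_mem x : x \in I -> galg_map reduce_exp x = 0.
Proof.
case/asboolP=> c ->; rewrite galg_map_sum; apply: big1 => b Pb.
rewrite /powers mulrBr mulr1 mulrC lvarX galg_mapB.
rewrite (@galg_map_shift _ _ _ _ 0) ?mul1r ?subrr // => k.
apply/ffunP => d; rewrite !ffunE; case: (eqVneq d b) => [->|_].
  by rewrite Pb add0r modzDl.
by rewrite !add0r.
Qed.

(** As [a] is outside [P], the normal form commutes with multiplication by x_a^l, and the claim
    reduces to regularity on R itself. *)
Lemma powers_reg_quot a l : ~~ P a -> (0 < l)%N ->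
  forall x, (lvar A a ^+ l - 1) * x \in I -> x \in I.
Proof.
move=> Pa l0 x /reduce_mem; rewrite lvarX mulrBl mul1r.
have redD k : reduce_exp (axis a l%:Z + k) = axis a l%:Z + reduce_exp k.
  apply/ffunP => b; rewrite !ffunE; case: (eqVneq b a) => [->|_]; last by rewrite !add0r.
  by rewrite (negPf Pa).
rewrite galg_mapB (galg_map_shift _ redD) -lvarX -[X in _ - X]mul1r -mulrBl.
move/(laurent_pow_reg l0) => x0.
by have := sub_reduce_mem x; rewrite x0 subr0.
Qed.

End NormalForm.

(** Its purpose is the finiteness of R_L, through the theorem on quotients by regular sequences. *)
Lemma powers_regular L : (forall a, 0 < L a)%N -> regular_seq (powers L).
Proof.
move=> L0 a; apply/nonzerodivisor_rpi; apply: powers_reg_quot => //.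
by rewrite /= ltnn.
Qed.

End LaurentPowers.

(** * Finite rings and modules *)

Lemma finite_setT_injP (T : choiceType) :
  finite_set [set: T] <-> exists n (e : T -> 'I_n), injective e.
Proof.
split=> [finT|[n [e e_inj]]].
  have memT x : x \in fset_set [set: T] by rewrite in_fset_set // mem_set.
  exists _, (fun x => enum_rank ([` memT x]%fset)) => x y /enum_rank_inj.
  by move/(congr1 val).
apply: contrapT => /(@infinite_set_fset _ _ n.+1)[B _]; rewrite ltnNge.
have /leq_card := inj_comp e_inj (@val_inj _ _ B).
by rewrite card_ord -cardfE => ->.
Qed.

Lemma card_of_finType (T : choiceType) (F : finType) (e : T -> F) :
  bijective e -> card_of T = #|F|.
Proof.
move=> [g eK gK]; have finT : finite_set [set: T].
  apply/finite_setT_injP; exists _, (enum_rank \o e).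
  exact: inj_comp enum_rank_inj (can_inj eK).
have memT x : x \in fset_set [set: T] by rewrite in_fset_set // mem_set.
rewrite /card_of cardfE; apply: (@bij_eq_card _ _ (e \o val)).
exists (fun y => [` memT (g y)]%fset) => [x|y] /=; last exact: gK.
by apply/val_inj; rewrite /= eK.
Qed.

Lemma finite_bij_ord (T : choiceType) : finite_set [set: T] ->
  exists e : T -> 'I_(card_of T), bijective e.
Proof.
move=> finT; have memT x : x \in fset_set [set: T] by rewrite in_fset_set // mem_set.
rewrite /card_of cardfE; pose B := fset_set [set: T].
pose e x : 'I_#|{: B}| := enum_rank ([` memT x]%fset : B).
exists e; exists (fun i => val (enum_val i : B)) => [x|i].
  by rewrite enum_rankK.
by apply: (canLR enum_valK); apply: val_inj.
Qed.

Lemma card_of_bij (T U : choiceType) (h : T -> U) : bijective h ->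
  finite_set [set: U] -> card_of T = card_of U.
Proof.
move=> h_bij /finite_bij_ord[e e_bij].
by rewrite (card_of_finType (bij_comp e_bij h_bij)) card_ord.
Qed.

Lemma card_finZmod_pgroup (F : finZmodType) p m : prime p ->
  (forall v : F, v *+ (p ^ m) = 0) -> exists k, #|F| = (p ^ k)%N.
Proof.
move=> p_pr Fp; exists (logn p #|[set: F]%SET|).
rewrite -(@cardsT F); apply: (@card_pgroup F p [set: F]%G).
rewrite -pnat_exponent; apply: (@pnat_dvd _ (p ^ m)); last by rewrite pnatX pnat_id.
by apply/exponentP => v _; apply: Fp.
Qed.

Lemma card_of_pgroup (V : zmodType) p m : prime p -> finite_set [set: V] ->
  (forall v : V, v *+ (p ^ m) = 0) -> exists k, card_of V = (p ^ k)%N.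
Proof.
move=> p_pr /finite_bij_ord[e [e' eK e'K]] Vp.
(* The bijection with an ordinal turns [V] into a finite abelian group, to which the theory of
   p-groups applies. *)
pose cV := CanIsCountable eK.
pose VC : countType := HB.pack V cV.
pose F := HB.pack_for finZmodType V cV (@CanIsFinite VC _ e e' eK).
have [|k Fk] := @card_finZmod_pgroup F p m p_pr; first exact: Vp.
by exists k; rewrite -Fk; apply: (@card_of_finType V F id); exists id.
Qed.

Section FiniteRing.
Variable S : comPzRingType.
Hypothesis finS : finite_set [set: S].

Lemma finite_pow_period (x : S) : exists i d, (0 < d)%N /\ x ^+ (i + d) = x ^+ i.
Proof.
have /finite_setT_injP[n [e e_inj]] := finS.
have /injectivePn[i [j ij /e_inj xij]] :
    ~~ injectiveb (fun i : 'I_n.+1 => e (x ^+ i)).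
  by apply/injectiveP => /leq_card; rewrite !card_ord ltnn.
wlog lt_ij : i j ij xij / (i < j)%N.
  move=> W; have [|ji|/val_inj E] := ltngtP i j; first exact: W xij.
    by apply: (W j i); rewrite // eq_sym.
  by rewrite E eqxx in ij.
by exists i, (j - i)%N; rewrite subn_gt0 subnKC ?(ltnW lt_ij).
Qed.

(** By pigeonhole the powers of [x] are eventually periodic; the unit x^i cancels from x^(i+d) =
    x^i. *)
Lemma finite_unit_order (x y : S) : x * y = 1 -> exists l, (0 < l)%N && (x ^+ l == 1).
Proof.
move=> xy; have [i [d [d0 xE]]] := finite_pow_period x.
have xyi : x ^+ i * y ^+ i = 1 by rewrite -exprMn xy expr1n.
by exists d; rewrite d0 -[_ ^+ d]mulr1 -xyi mulrA -exprD addnC xE eqxx.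
Qed.

(* Some power e of s t is idempotent; w is t on the factor e and 1 on the
   other one. *)
Lemma finite_associates (a b s t : S) : a = b * s -> b = a * t ->
  exists w w', w * w' = 1 /\ b = w * a.
Proof.
move=> aE bE; have [i [d [d0 xE]]] := finite_pow_period (s * t).
have per j k : (s * t) ^+ (i + j + k * d) = (s * t) ^+ (i + j).
  elim: k => [|k IH]; first by rewrite addn0.
  by rewrite -IH mulSn addnACA exprD xE -exprD addnA.
(* A multiple of the period d that is at least the preperiod i, so that doubling the exponent leaves
   the power unchanged. *)
pose k := (i.+1 * d)%N; pose e := (s * t) ^+ k.
have ee : e * e = e.
  have ik : (i <= k)%N by apply: leq_trans (leq_pmulr _ d0).
  by rewrite /e -exprD -{1}(subnKC ik) per subnKC.
have ae : a * e = a.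
  have ast : a * (s * t) = a by rewrite [s * t]mulrC mulrA -bE -aE.
  have aX l : a * (s * t) ^+ l = a.
    by elim: l => [|l IH]; rewrite ?expr0 ?mulr1 // exprS mulrA ast.
  exact: aX.
have ek : e = s * t * (s * t) ^+ k.-1 by rewrite -exprS prednK // muln_gt0 d0.
(* On the factor [e], t is inverted by s (st)^(k-1), as their product is (st)^k = e; and [a] lives
   on that factor because a s t = a. *)
exists (t * e + (1 - e)), (s * (s * t) ^+ k.-1 * e + (1 - e)); split.
  move: ee ek; set r := _ ^+ k.-1; move: (e) => e1 ee /esym ek; ring: ee ek.
by rewrite mulrDl mulrBl mul1r -mulrA ![e * a]mulrC ae subrr addr0 mulrC.
Qed.

End FiniteRing.

Lemma mult_order_gt0 (S : pzRingType) (x : S) :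
  (exists l, (0 < l)%N && (x ^+ l == 1)) -> (0 < mult_order x)%N.
Proof.
rewrite /mult_order; case: pselect => // ex _.
by case: ex_minnP => l /andP[].
Qed.

(** One divisibility is the geometric sum. For the other, Bezout in the form u l = v n + gcd gives
    x^(u l) = x^gcd; [0 < l] provides natural coefficients. *)
Lemma subX1_gcd (S : comPzRingType) (x : S) l n : (0 < l)%N -> x ^+ n = 1 ->
  exists s t, x ^+ l - 1 = (x ^+ gcdn l n - 1) * s /\
              x ^+ gcdn l n - 1 = (x ^+ l - 1) * t.
Proof.
move=> l0 xn; have dvd_sub k i : exists s, x ^+ (k * i) - 1 = (x ^+ k - 1) * s.
  by exists (\sum_(j < i) (x ^+ k) ^+ j); rewrite -subrX1 exprM.
have [s sE] := dvd_sub (gcdn l n) (l %/ gcdn l n)%N.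
have [u v uv _] := egcdnP n l0; have [t tE] := dvd_sub l u.
exists s, t; rewrite -sE -tE mulnC divnK ?dvdn_gcdl //; split=> //.
by rewrite mulnC uv exprD mulnC exprM xn expr1n mul1r.
Qed.

(** Presents R_L and R_L', for L and L' differing only at [a], as quotients of one module M by one
    element each. *)
Lemma rquot_proj (R : comPzRingType) n (g h : 'I_n -> R) a :
  (forall b, b != a -> g b = h b) ->
  exists phi : {linear rquot (ideal_gen (predC1 a) g) -> rmod h},
    (forall x, exists x0, phi x0 = x) /\
    (forall x, phi x = 0 <-> exists e, x = h a *: e).
Proof.
move=> gh; pose I := ideal_gen (predC1 a) g; pose J := ideal_gen predT h.
have IJ : {subset I <= J}.
  by apply: ideal_gen_sub => b /gh ->; apply: mem_ideal_gen.
pose phi (x : rquot I) : rmod h := rpi J (mrepr x).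
have phiE r : phi (rpi I r) = rpi J r.
  apply/eqP; rewrite mpi_eq; apply: IJ.
  by rewrite -(mpi_eq I) mreprK.
have phi_lin : linear phi.
  move=> r x y; have [x0 <-] := rpi_surj x; have [y0 <-] := rpi_surj y.
  by rewrite !rquot_scaleE -rmorphM -rmorphD !phiE rmorphD rmorphM.
exists (HB.pack_for {linear rquot I -> rmod h} phi
  (GRing.isLinear.Build R (rquot I) (rmod h) *:%R phi phi_lin)).
split=> [x|x] /=; first by have [r <-] := rpi_surj x; exists (rpi I r).
have [r <-] := rpi_surj x; rewrite phiE; split=> [/rpi_eq0/asboolP[c rE]|[e]].
  exists (rpi I (c a)); rewrite rquot_scaleE -rmorphM; apply/eqP.
  rewrite -subr_eq0 -rmorphB; apply/eqP/rpi_eq0/asboolP.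
  exists c; rewrite rE (bigD1 a) //= [h a * _]mulrC addrAC subrr add0r.
  by apply: eq_bigr => b ba; rewrite gh.
have [e0 <-] := rpi_surj e; rewrite rquot_scaleE -rmorphM => /eqP.
rewrite -subr_eq0 -rmorphB => /eqP/rpi_eq0/IJ rJ; apply/rpi_eq0.
rewrite -(subrK (h a * e0) r); apply: (@rpredD _ J) => //.
by rewrite mulrC; apply: ideal_genMl; apply: mem_ideal_gen.
Qed.

(** * Koszul homology of the quotients R_L *)

Section HomologyOfQuotients.
Variables (D : nat) (A : comNzRingType).
Local Notation R := (laurent D A).
Implicit Types (f : 'I_D -> R) (L : 'I_D -> nat).

Lemma HZ_change f L L' a w w' (c t : 'I_D -> R) j :
  (0 < L a)%N -> (0 < L' a)%N -> (forall b, b != a -> L b = L' b) ->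
  powers A L' a = w * powers A L a + \sum_b c b * f b ->
  w * w' = 1 - \sum_b t b * f b ->
  lmod_iso (HZ f L j) (HZ f L' j).
Proof.
move=> La L'a LL' yE wE; pose I := ideal_gen (predC1 a) (powers A L).
have [p [p_surj p_ker]] := @rquot_proj R D (powers A L) (powers A L) a (fun _ _ => erefl).
have LL'p b : b != a -> powers A L b = powers A L' b by move=> ba; rewrite /powers LL'.
have [p' [p'_surj p'_ker]] := rquot_proj LL'p.
have reg l : (0 < l)%N -> forall x : rquot I, (lvar A a ^+ l - 1 : R) *: x = 0 -> x = 0.
  move=> l0 x; rewrite rquot_scaleE; move: x; apply/nonzerodivisor_rpi.
  by apply: powers_reg_quot; rewrite //= eqxx.
exact: (koszulH_change p_surj p'_surj p_ker p'_ker (reg _ La) (reg _ L'a) yE wE).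
Qed.

(** x_a is a unit of R, with inverse the monomial of exponent -1, so its class in a finite quotient
    has finite order. *)
Lemma Jord_gt0 f a : finite_set [set: rmod f] -> (0 < Jord f a)%N.
Proof.
move=> finS; apply: mult_order_gt0.
apply: (finite_unit_order finS (y := rpi (ideal_gen predT f) (<< axis a (-1) >> : R))).
rewrite -rmorphM -[lvar A a]expr1 lvarX -galg_UE -axisD subrr -[RHS](rmorph1 (rpi _)).
congr (rpi _ _); rewrite -[RHS]/(<< 0 >> : R); congr mkmalgU.
by apply/ffunP => b; rewrite !ffunE if_same.
Qed.

Lemma HZ_gcd f L j : finite_set [set: rmod f] -> (forall a, 0 < L a)%N ->
  lmod_iso (HZ f L j) (HZ f (fun a => gcdn (L a) (Jord f a)) j).
Proof.
move=> finS L0; pose g a := gcdn (L a) (Jord f a).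
have g0 a : (0 < g a)%N by rewrite gcdn_gt0 L0.
(* Interpolates between [L] at i = 0 and [g] at i = D, changing one coordinate at each step. *)
pose M i (a : 'I_D) := if (a < i)%N then g a else L a.
have M0 i a : (0 < M i a)%N by rewrite /M; case: ifP.
have iso i : (i <= D)%N -> lmod_iso (HZ f L j) (HZ f (M i) j).
  elim: i => [_|i IH iD].
    have -> : M 0%N = L by apply/funext.
    by exists idfun; exists id.
  pose a := Ordinal iD; apply: lmod_iso_trans (IH (ltnW iD)) _.
  have Mi : M i a = L a by rewrite /M /= ltnn.
  have Mi1 : M i.+1 a = g a by rewrite /M /= ltnSn.
  pose J := ideal_gen predT f; pose pi := rpi J.
  have powE K : pi (powers A K a) = pi (lvar A a) ^+ K a - 1.
    by rewrite /pi rmorphB rmorphXn rmorph1.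
  have piM x y : pi (x * y) = pi x * pi y by exact: rmorphM.
  have memJ x y : pi x = pi y -> x - y \in J.
    by move=> xy; rewrite -(mpi_eq J); apply/eqP.
  have [xJ _] := mult_orderP (Jord_gt0 a finS).
  have [s [t [sE tE]]] := subX1_gcd (L0 a) xJ.
  have [w0 [w'0 [ww0 gE]]] := finite_associates finS sE tE.
  (* Lifted to R, the identities between associates in R/(f) hold up to elements of (f), whose
     coefficients are [c] and [d]. *)
  have [w wE] := rpi_surj w0; have [w' w'E] := rpi_surj w'0.
  have /asboolP[c cE] : powers A (M i.+1) a - w * powers A (M i) a \in J.
    by apply: memJ; rewrite piM !powE Mi Mi1 [pi w]wE.
  have /asboolP[d dE] : 1 - w * w' \in J.
    by apply: memJ; rewrite piM [pi w]wE [pi w']w'E ww0.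
  apply: (@HZ_change f (M i) (M i.+1) a w w' c d) => // [b ba||].
  - rewrite /M ltnS [(b <= i)%N]leq_eqVlt.
    by have /negPf -> : nat_of_ord b != i by rewrite -val_eqE in ba.
  - by rewrite -cE addrC subrK.
  - by rewrite -dE opprB addrC subrK.
have -> : (fun a => gcdn (L a) (Jord f a)) = M D.
  by apply/funext => a; rewrite /M ltn_ord.
exact: iso.
Qed.

(** A class is determined by the finitely many R_L-coordinates of a chosen representing cycle. *)
Lemma finite_HZ f L j : finite_set [set: R_quo A L] ->
  finite_set [set: HZ f L j].
Proof.
move=> /finite_setT_injP[n [e e_inj]]; apply/finite_setT_injP.
pose code (u : kos D (R_quo A L) j) : {ffun isub D j -> 'I_n} := [ffun B => e (u B)].
have code_inj : injective code.
  move=> u v /ffunP uv; apply/ffunP => B; have := uv B.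
  by rewrite !ffunE => /e_inj.
pose rep (z : HZ f L j) := val (mrepr z).
exists _, (enum_rank \o (code \o rep)); apply: inj_comp enum_rank_inj _.
apply: inj_comp code_inj _; apply: inj_comp val_inj _.
exact: can_inj (@mreprK _ _ _).
Qed.

End HomologyOfQuotients.

(** * Coefficients modulo p^m and cardinalities *)

Lemma finite_rmod_Zp D q (f : 'I_D -> laurent D 'Z_q) :
  regular_seq f -> finite_set [set: rmod f].
Proof. exact: (@finite_rmod_regular _ _ (Zp_trunc q).+2 id). Qed.

Lemma laurent_Zp_char D q (V : lmodType (laurent D 'Z_q)) (v : V) :
  (1 < q)%N -> v *+ q = 0.
Proof.
move=> q1; rewrite -scaler_nat; suff -> : (q%:R : laurent D 'Z_q) = 0 by rewrite scale0r.
rewrite -[1]/(<< 1 *g 0 >> : {malg 'Z_q[{ffun 'I_D -> int}]}).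
rewrite -(monalgUMn (0 : {ffun 'I_D -> int}) q (1 : 'Z_q)).
by rewrite pchar_Zp // monalgU0.
Qed.

(** Being killed by p^m, the finite group [M] has order a power of p, so the truncated logarithm is
    exact. *)
Lemma lmod_iso_log_card (R : pzRingType) (M N : lmodType R) p m :
  prime p -> lmod_iso M N -> finite_set [set: M] -> finite_set [set: N] ->
  (forall v : M, v *+ (p ^ m) = 0) ->
  card_of M = (p ^ trunc_log p (card_of M))%N /\
  trunc_log p (card_of M) = trunc_log p (card_of N).
Proof.
move=> p_pr [phi phi_bij] finM finN Mp.
have [k kE] := card_of_pgroup p_pr finM Mp.
split; first by rewrite kE trunc_expnK ?prime_gt1.
by congr trunc_log; exact: card_of_bij phi_bij finN.
Qed.

Lemma HZ_gcd_Zp p m D q (f : 'I_D -> laurent D 'Z_q) L j :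
  q = (p ^ m)%N -> prime p -> (0 < m)%N -> regular_seq f ->
  (forall a, 0 < L a)%N -> let g := fun a => gcdn (L a) (Jord f a) in
  [/\ lmod_iso (HZ f L j) (HZ f g j), finite_set [set: HZ f L j],
      card_of (HZ f L j) = (p ^ kZ p f L j)%N & kZ p f L j = kZ p f g j].
Proof.
move=> qE p_pr m0 f_reg L0 g.
have q1 : (1 < q)%N by rewrite qE -(exp1n m) ltn_exp2r ?prime_gt1.
have g0 a : (0 < g a)%N by rewrite gcdn_gt0 L0.
have finH K : (forall a, 0 < K a)%N -> finite_set [set: HZ f K j].
  by move=> K0; apply/finite_HZ/finite_rmod_Zp/powers_regular.
have iso := HZ_gcd j (finite_rmod_Zp f_reg) L0.
have qH (v : HZ f L j) : v *+ (p ^ m) = 0 by rewrite -qE; apply: laurent_Zp_char.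
have [cardE logE] := lmod_iso_log_card p_pr iso (finH L L0) (finH g g0) qH.
split; [exact: iso | exact: finH | exact: cardE | exact: logE].
Qed.

(** The finiteness, positivity and cardinality clauses certify that [Jord], [card_of] and [kZ] have
    their intended meaning here: a genuine order, a genuine cardinality and an exact logarithm
    rather than default or rounded values. *)
Theorem fact8 (p m D : nat) (f : 'I_D -> laurent D 'Z_(p ^ m)) :
  prime p -> (0 < m)%N -> regular_seq f ->
  [/\ finite_set [set: rmod f],
      forall a, (0 < Jord f a)%N &
      forall L : 'I_D -> nat, (forall a, (0 < L a)%N) ->
      let g := fun a => gcdn (L a) (Jord f a) in
      forall j : nat,
      [/\ lmod_iso (HZ f L j) (HZ f g j),
          finite_set [set: HZ f L j],
          card_of (HZ f L j) = (p ^ kZ p f L j)%N &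
          kZ p f L j = kZ p f g j]].
Proof.
move=> p_pr m0 f_reg; have finS := finite_rmod_Zp f_reg.
split=> [|a|L L0 g j]; [exact: finS | exact: Jord_gt0 |].
exact: (HZ_gcd_Zp j erefl p_pr m0 f_reg L0).
Qed.
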